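(* Let $V$ be a Euclidean space, that is, a real vector space with a positive definite inner product $\langle\cdot,\cdot\rangle$, and let $d(u,v)=\langle u-v,u-v\rangle^{1/2}$ be its Euclidean metric. If $\dim V\geq 2$ then $C(V,d)=C_0(V,d)=\sqrt{2}$.
   Context: For a metric space $(X,d)$ and $\mu,\delta \geq 0$, say that $(X,d)$ satisfies the $(\mu,\delta)$-four-point inequality if for all $x,y,z,w\in X$, $d(x,y)+d(z,w)\le \mu\max\{d(x,z)+d(y,w),\ d(x,w)+d(y,z)\}+2\delta$. The quasi-hyperbolicity constant of $(X,d)$ is $C(X,d)=\inf\{\mu\geq 0\mid \text{there exists }\delta\geq 0\text{ such that }(X,d)\text{ satisfies the }(\mu,\delta)\text{-four-point inequality}\}$, and the quadrilateral constant is $C_0(X,d)=\inf\{\mu\geq 0 \mid (X,d)\text{ satisfies the }(\mu,0)\text{-four-point inequality}\}$. *)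

(* Defs.v *)
From HB Require Import structures.
From mathcomp Require Import all_boot all_order all_algebra.
From mathcomp Require Import sesquilinear.
From mathcomp Require Import all_classical all_reals all_analysis.
From mathcomp Require Import ring lra.

Set Implicit Arguments.
Unset Strict Implicit.
Unset Printing Implicit Defensive.

Import Order.TTheory GRing.Theory Num.Theory.

Local Open Scope classical_set_scope.
Local Open Scope ring_scope.

Definition four_point_ineq (R : realType) (X : metricType R) (mu delta : R) :
    Prop :=
  forall x y z w : X,
    mdist x y + mdist z w <=
      mu * Num.max (mdist x z + mdist y w) (mdist x w + mdist y z) + 2 * delta.

(* [inf] is the real-valued infimum, with junk value 0 on the empty set.  Both
   sets below are bounded below by 0 and, by the triangle inequality, contain
   2, so these are genuine infima on every metric space. *)
Definition quasi_hyperbolicity_constant (R : realType) (X : metricType R) : R :=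
  inf [set mu | 0 <= mu /\
                exists delta, 0 <= delta /\ four_point_ineq X mu delta].

Definition quadrilateral_constant (R : realType) (X : metricType R) : R :=
  inf [set mu | 0 <= mu /\ four_point_ineq X mu 0].

(* [V] need not be finite-dimensional, so there is no [\dim]: dimension at
   least [n] means that some family of [n] vectors is linearly independent. *)
Definition dim_ge (R : realType) (V : lmodType R) (n : nat) : Prop :=
  exists e : 'I_n -> V,
    forall a : 'I_n -> R, \sum_(i < n) a i *: e i = 0 -> forall i, a i = 0.

(* Over [R] with [theta := idfun], [{dot V for idfun}] is the type of symmetric
   positive definite bilinear forms on [V].  [euclidean ip] is a copy of [V]
   that carries the metric induced by [ip]. *)
Definition euclidean (R : realType) (V : lmodType R)
  (ip : {dot V for @idfun R}) : Type := V.

Definition euclidean_dist (R : realType) (V : lmodType R)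
  (ip : {dot V for @idfun R}) (u v : V) : R := Num.sqrt (ip (u - v) (u - v)).

Section euclidean_metric.
Context {R : realType} {V : lmodType R} (ip : {dot V for @idfun R}).

Lemma ip_sym u v : ip u v = ip v u.
Proof. by rewrite (hermC ip) /= expr0 mul1r. Qed.

Lemma ip_gt0 u : u != 0 -> 0 < ip u u.
Proof. exact: neq0_dnorm_gt0. Qed.

Lemma ip_ge0 u : 0 <= ip u u.
Proof.
by have [->|/ip_gt0/ltW//] := eqVneq u 0; rewrite linear0l.
Qed.

Lemma ipZl t u v : ip (t *: u) v = t * ip u v.
Proof. by rewrite linearZl_LR. Qed.

Lemma ipZr t u v : ip u (t *: v) = t * ip u v.
Proof. by rewrite ip_sym ipZl ip_sym. Qed.

Lemma ipDZ u v t :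
  ip (u + t *: v) (u + t *: v) = ip u u + 2 * t * ip u v + t ^+ 2 * ip v v.
Proof.
rewrite linearDl !linearDr /= !ipZl !ipZr (ip_sym v u).
by ring.
Qed.

Lemma ip_cauchy_schwarz u v : ip u v ^+ 2 <= ip u u * ip v v.
Proof.
have [->|v0] := eqVneq v 0; first by rewrite -(scale0r u) !ipZr !mul0r expr0n mulr0.
have vv := ip_gt0 v0.
have := ip_ge0 (u + (- (ip u v / ip v v)) *: v).
rewrite ipDZ => /(mulr_ge0 (ltW vv)).
suff -> : ip v v * (ip u u + 2 * - (ip u v / ip v v) * ip u v +
    (- (ip u v / ip v v)) ^+ 2 * ip v v) = ip u u * ip v v - ip u v ^+ 2.
  by rewrite subr_ge0.
by field; rewrite gt_eqF.
Qed.

Lemma euclidean_distxx u : euclidean_dist ip u u = 0.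
Proof. by rewrite /euclidean_dist subrr linear0r sqrtr0. Qed.

Lemma euclidean_dist_positivity u v : euclidean_dist ip u v = 0 -> u = v.
Proof.
move=> /eqP; rewrite sqrtr_eq0 => uv0; apply/eqP; rewrite -subr_eq0.
by apply: contraTT uv0 => /ip_gt0; rewrite -ltNge.
Qed.

Lemma euclidean_dist_sym u v : euclidean_dist ip u v = euclidean_dist ip v u.
Proof.
by rewrite /euclidean_dist -(opprB v u) linearNl linearNr /= opprK.
Qed.

Lemma euclidean_dist_triangle v u w :
  euclidean_dist ip u w <= euclidean_dist ip u v + euclidean_dist ip v w.
Proof.
rewrite /euclidean_dist.
have -> : u - w = (u - v) + 1 *: (v - w) by rewrite scale1r subrKA.
move: (u - v) (v - w) => a b.
rewrite -[leRHS]ger0_norm ?addr_ge0 ?sqrtr_ge0// -sqrtr_sqr ler_wsqrtr//.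
rewrite ipDZ sqrrD !sqr_sqrtr ?ip_ge0// mulr1 expr1n mul1r lerD2r lerD2l.
rewrite -(mulr_natl (_ * _)) ler_pM2l ?ltr0n// -sqrtrM ?ip_ge0//.
rewrite (le_trans (ler_norm _))// -sqrtr_sqr ler_wsqrtr//.
exact: ip_cauchy_schwarz.
Qed.

HB.instance Definition _ := Choice.copy (euclidean ip) V.
HB.instance Definition _ := isMetric.Build R (euclidean ip)
  euclidean_distxx euclidean_dist_positivity euclidean_dist_sym
  euclidean_dist_triangle.

Lemma euclidean_mdistE (u v : euclidean ip) :
  mdist u v = Num.sqrt (ip ((u : V) - v) ((u : V) - v)).
Proof. by []. Qed.

End euclidean_metric.

(* Main.v *)
Require Import Defs.
From mathcomp Require Import all_boot all_order all_algebra.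
From mathcomp Require Import sesquilinear.
From mathcomp Require Import all_classical all_reals all_analysis.
From mathcomp Require Import ring lra.
Import Order.TTheory GRing.Theory Num.Theory.
Local Open Scope ring_scope.

(** Write [p, q] for the diagonals of a quadrilateral, and [(a, b)], [(c, e)]
    for its two pairs of opposite sides.

    Upper bound.  Two classical inequalities hold in every inner product space:
    the quadrilateral inequality [p^2 + q^2 <= a^2 + b^2 + c^2 + e^2]
    ([euclidean_dist_quadrilateral]) and Ptolemy's inequality
    [p q <= a b + c e] ([euclidean_dist_ptolemy]).  Adding twice the second to
    the first gives [(p + q)^2 <= (a + b)^2 + (c + e)^2], which is at most
    [2 max(a + b, c + e)^2].  So [Num.sqrt 2] satisfies the four-point
    inequality with [delta = 0].

    Lower bound.  In a square both inequalities are equalities, and the ratio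
    of [p + q] to [a + b = c + e] is exactly [Num.sqrt 2].  In dimension at least
    two there are arbitrarily large squares, so no additive constant [delta]
    can make up for a factor [mu < Num.sqrt 2].

    Hence [Num.sqrt 2] is the minimum of both sets of admissible factors. *)

Lemma inf_eq_min (R : realType) (A : set R) (m : R) :
  A m -> lbound A m -> inf A = m.
Proof.
move=> Am lbm; apply/eqP; rewrite eq_le; apply/andP; split.
  by apply: ge_inf => //; exists m.
by apply: lb_le_inf => //; exists m.
Qed.

Section InnerProduct.
Context {R : realType} {V : lmodType R} (ip : {dot V for @idfun R}).
Implicit Types u v w x y z : V.

Local Notation dist := (euclidean_dist ip).

Lemma ip_sub u v : ip (u - v) (u - v) = ip u u - 2 * ip u v + ip v v.
Proof. by rewrite -scaleN1r ipDZ; ring. Qed.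

Lemma euclidean_dist_ge0 u v : 0 <= dist u v.
Proof. exact: sqrtr_ge0. Qed.

Lemma sqr_euclidean_dist u v : dist u v ^+ 2 = ip (u - v) (u - v).
Proof. by rewrite sqr_sqrtr// ip_ge0. Qed.

Lemma sqr_euclidean_distr0 u : dist u 0 ^+ 2 = ip u u.
Proof. by rewrite sqr_euclidean_dist subr0. Qed.

Lemma euclidean_dist_subr w u v : dist (u - w) (v - w) = dist u v.
Proof. by rewrite /euclidean_dist opprB addrA subrK. Qed.

Lemma euclidean_dist_subr0 u v : dist (u - v) 0 = dist u v.
Proof. by rewrite /euclidean_dist subr0. Qed.

(** The difference of the two sides is the squared norm of [x + y - z - w],
    which vanishes exactly when the quadrilateral is a parallelogram. *)
Lemma euclidean_dist_quadrilateral x y z w :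
  dist x y ^+ 2 + dist z w ^+ 2 <=
  dist x z ^+ 2 + dist y w ^+ 2 + dist x w ^+ 2 + dist y z ^+ 2.
Proof.
rewrite -(euclidean_dist_subr w x y) -(euclidean_dist_subr w x z).
rewrite -(euclidean_dist_subr w y z) -(euclidean_dist_subr0 z w).
rewrite -(euclidean_dist_subr0 y w) -(euclidean_dist_subr0 x w).
move: (x - w) (y - w) (z - w) => a b c.
rewrite !sqr_euclidean_distr0 !sqr_euclidean_dist !ip_sub.
have := ip_ge0 ip ((a - c) + 1 *: b).
rewrite ipDZ ip_sub linearBl /= (ip_sym ip c b).
by lra.
Qed.

(** The inversion [u |-> u / |u|^2] multiplies the distance between [u] and
    [v] by [1 / (|u| |v|)].  This is that rule after clearing denominators,
    which makes it hold at the origin too; the free factor [c] allows three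
    points to be inverted with one common denominator. *)
Lemma euclidean_dist_inversion u v c :
  dist ((c * ip v v) *: u) ((c * ip u u) *: v) =
  `|c| * dist u 0 * dist v 0 * dist u v.
Proof.
apply/eqP; rewrite -(eqrXn2 (n := 2))// ?mulr_ge0 ?euclidean_dist_ge0//.
rewrite !exprMn real_normK ?num_real// !sqr_euclidean_distr0.
rewrite !sqr_euclidean_dist !ip_sub !ipZl !ipZr.
by apply/eqP; ring.
Qed.

(** Ptolemy's inequality at the origin: it is the triangle inequality for the
    images of [x, y, z] under inversion, multiplied by [|x| |y| |z|]. *)
Lemma euclidean_dist_ptolemy0 x y z :
  dist x y * dist z 0 <= dist x z * dist y 0 + dist x 0 * dist y z.
Proof.
have [->|x0] := eqVneq x 0.
  rewrite euclidean_distxx mul0r addr0 mulrC.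
  by rewrite (euclidean_dist_sym ip 0 y) (euclidean_dist_sym ip 0 z).
have [->|y0] := eqVneq y 0.
  by rewrite euclidean_distxx mulr0 add0r (euclidean_dist_sym ip 0 z).
have [->|z0] := eqVneq z 0.
  by rewrite euclidean_distxx mulr0 addr_ge0 ?mulr_ge0 ?euclidean_dist_ge0.
have pos u : u != 0 -> 0 < dist u 0.
  by move=> u0; rewrite /euclidean_dist subr0 sqrtr_gt0 ip_gt0.
have := euclidean_dist_triangle ip ((ip y y * ip x x) *: z)
  ((ip z z * ip y y) *: x) ((ip z z * ip x x) *: y).
rewrite euclidean_dist_inversion.
rewrite [ip z z * ip y y]mulrC euclidean_dist_inversion.
rewrite [ip y y * ip x x]mulrC [ip z z * ip x x]mulrC.
rewrite (euclidean_dist_sym ip (_ *: z)) euclidean_dist_inversion.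
rewrite !ger0_norm ?ip_ge0// -!sqr_euclidean_distr0.
move=> H; rewrite -(ler_pM2l (mulr_gt0 (mulr_gt0 (pos x x0) (pos y y0)) (pos z z0))).
by move: H; congr (_ <= _); ring.
Qed.

Lemma euclidean_dist_ptolemy x y z w :
  dist x y * dist z w <= dist x z * dist y w + dist x w * dist y z.
Proof.
have := euclidean_dist_ptolemy0 (x - w) (y - w) (z - w).
by rewrite !euclidean_dist_subr !euclidean_dist_subr0.
Qed.

Lemma euclidean_four_point_ineq : four_point_ineq (euclidean ip) (Num.sqrt 2) 0.
Proof.
move=> x y z w; rewrite mulr0 addr0.
change (dist x y + dist z w <=
  Num.sqrt 2 * Num.max (dist x z + dist y w) (dist x w + dist y z)).
have := euclidean_dist_quadrilateral x y z w.
have := euclidean_dist_ptolemy x y z w.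
have := euclidean_dist_ge0 x y; have := euclidean_dist_ge0 z w.
have := euclidean_dist_ge0 x z; have := euclidean_dist_ge0 y w.
have := euclidean_dist_ge0 x w; have := euclidean_dist_ge0 y z.
move: (dist x y) (dist z w) (dist x z) (dist y w) (dist x w) (dist y z).
move=> p q a b c e e0 c0 b0 a0 q0 p0 pq_le p2q2_le.
set M := Num.max _ _.
have abM : a + b <= M by rewrite le_max lexx.
have ceM : c + e <= M by rewrite le_max lexx orbT.
have M0 : 0 <= M by rewrite (le_trans _ abM)// addr_ge0.
rewrite -ler_sqr ?nnegrE ?mulr_ge0 ?addr_ge0 ?sqrtr_ge0//.
rewrite exprMn sqr_sqrtr ?ler0n//.
have ab2 : (a + b) ^+ 2 <= M ^+ 2 by rewrite lerXn2r ?nnegrE ?addr_ge0.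
have ce2 : (c + e) ^+ 2 <= M ^+ 2 by rewrite lerXn2r ?nnegrE ?addr_ge0.
by lra.
Qed.

(** One Gram-Schmidt step, rescaled by the ratio of the norms. *)
Lemma dim_ge2_orthogonal : dim_ge V 2 ->
  exists u v, [/\ 0 < ip u u, ip v v = ip u u & ip u v = 0].
Proof.
case=> e free_e; set a := e ord0; set b := e ord_max.
have indep s t : s *: a + t *: b = 0 -> s = 0 /\ t = 0.
  move=> st0; have := free_e (fun i => if i == ord0 then s else t).
  rewrite big_ord_recl big_ord1 /= (_ : lift _ _ = ord_max); last exact/val_inj.
  by move=> /(_ st0) h; split; [exact: (h ord0) | exact: (h ord_max)].
have a_neq0 : a != 0.
  apply/eqP => a0; have [] := indep 1 0; first by rewrite a0 scaler0 scale0r addr0.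
  by move/eqP; rewrite oner_eq0.
have a_gt0 := ip_gt0 ip a_neq0.
set k := ip a b / ip a a; set c := b + (- k) *: a.
have c_neq0 : c != 0.
  apply/eqP => c0; have [|_ /eqP] := indep (- k) 1.
    by rewrite scale1r addrC.
  by rewrite oner_eq0.
have c_gt0 := ip_gt0 ip c_neq0.
exists a, (Num.sqrt (ip a a / ip c c) *: c); split=> //.
  rewrite ipZl ipZr mulrA -expr2 sqr_sqrtr ?divr_ge0 ?ip_ge0//.
  by rewrite divfK// gt_eqF.
suff ac0 : ip a c = 0 by rewrite ipZr ac0 mulr0.
by rewrite linearDr /= ipZr mulNr divfK ?subrr// gt_eqF.
Qed.

(** The vertices [t u, - t u, t v, - t v] form a square whose size grows with
    [t], while [delta] stays fixed. *)
Lemma sqrt2_le_four_point mu delta : dim_ge V 2 ->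
  four_point_ineq (euclidean ip) mu delta -> Num.sqrt 2 <= mu.
Proof.
move=> /dim_ge2_orthogonal[u [v [u_gt0 vvE uv0]]] mu_delta.
set n := Num.sqrt (ip u u).
have n_gt0 : 0 < n by rewrite sqrtr_gt0.
have diag w t : ip w w = ip u u -> 0 <= t -> dist (t *: w) (- (t *: w)) = 2 * t * n.
  move=> wwE t0; rewrite /euclidean_dist opprK -mulr2n -scaler_nat scalerA.
  rewrite ipZl ipZr mulrA -expr2 wwE sqrtrM ?sqr_ge0// sqrtr_sqr ger0_norm//.
  by rewrite mulr_ge0.
have side r s t : r ^+ 2 = t ^+ 2 -> s ^+ 2 = t ^+ 2 -> 0 <= t ->
    dist (r *: u) (s *: v) = Num.sqrt 2 * t * n.
  move=> r2 s2 t0; rewrite /euclidean_dist ip_sub !ipZl !ipZr uv0 vvE.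
  rewrite !mulr0 subr0 !mulrA -!expr2 r2 s2.
  have -> : t ^+ 2 * ip u u + t ^+ 2 * ip u u = 2 * (t ^+ 2 * ip u u) by ring.
  by rewrite sqrtrM// sqrtrM ?sqr_ge0// sqrtr_sqr ger0_norm// mulrA.
have square t : 0 <= t -> 2 * (2 * t * n) <= mu * (2 * (Num.sqrt 2 * t * n)) + 2 * delta.
  move=> t0; have := mu_delta (t *: u) (- (t *: u)) (t *: v) (- (t *: v)).
  change (dist (t *: u) (- (t *: u)) + dist (t *: v) (- (t *: v)) <=
    mu * Num.max
      (dist (t *: u) (t *: v) + dist (- (t *: u)) (- (t *: v)))
      (dist (t *: u) (- (t *: v)) + dist (- (t *: u)) (t *: v))
    + 2 * delta -> 2 * (2 * t * n) <= mu * (2 * (Num.sqrt 2 * t * n)) + 2 * delta).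
  (* All four sides of the square have the same length, so the two arguments of
     the maximum agree. *)
  rewrite (diag u t)// (diag v t)// -!scaleNr.
  have tN : (- t) ^+ 2 = t ^+ 2 by rewrite sqrrN.
  rewrite (side t t t)// (side (- t) (- t) t)//.
  rewrite (side t (- t) t)// (side (- t) t t)// maxxx.
  have double (r : R) : r + r = 2 * r by ring.
  by rewrite !double.
rewrite leNgt; apply/negP => mu_lt.
set s := Num.sqrt 2 in square mu_lt.
have s2 : s ^+ 2 = 2 by rewrite sqr_sqrtr.
have s_gt0 : 0 < s by rewrite sqrtr_gt0.
have k_gt0 : 0 < s * n * (s - mu) by rewrite !mulr_gt0// subr_gt0.
(* Since [2 = s ^+ 2], the inequality for the square of half-diagonal [t * n]
   reads [t * (s * n * (s - mu)) <= delta]; this [t] makes the left-hand side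
   exceed [delta]. *)
have [t t_ge0 tE] : exists2 t, 0 <= t & t * (s * n * (s - mu)) = `|delta| + 1.
  exists ((`|delta| + 1) / (s * n * (s - mu))).
    by rewrite divr_ge0 ?addr_ge0// ltW.
  by rewrite divfK// gt_eqF.
have := square t t_ge0.
have -> : 2 * (2 * t * n) = 2 * (s ^+ 2 * t * n) by rewrite s2.
have := ler_norm delta.
by lra.
Qed.

End InnerProduct.

Theorem proposition4p4 (R : realType) (V : lmodType R)
    (ip : {dot V for @idfun R}) :
  dim_ge V 2 ->
  quasi_hyperbolicity_constant (euclidean ip) = Num.sqrt 2 /\
  quadrilateral_constant (euclidean ip) = Num.sqrt 2.
Proof.
move=> dim2; have sqrt2P := euclidean_four_point_ineq ip.
split; apply: inf_eq_min.
- by split; [exact: sqrtr_ge0 | exists 0].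
- by move=> mu [_ [delta [_ /(sqrt2_le_four_point ip mu delta dim2)]]].
- by split; first exact: sqrtr_ge0.
- by move=> mu [_ /(sqrt2_le_four_point ip mu 0 dim2)].
Qed.
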